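(* Let $T>0$, $\omega_0=2\pi/T$, $N\ge0$, and let $\mathcal G$ be the single-input/single-output linear time-periodic system $$\dot{\mathbf x}(t)=\mathbf Q\mathbf x(t)+\mathbf b(t)u(t),\qquad y(t)=\mathbf c^T(t)\mathbf x(t),$$ with constant $\mathbf Q\in\mathbb R^{n\times n}$ and $T$-periodic $\mathbf b(t),\mathbf c(t)\in\mathbb R^n$ having finite Fourier expansions $$\mathbf b(t)=\sum_{k=-N}^N\mathbf b_ke^{-\mathrm ik\omega_0t},\qquad\mathbf c(t)=\sum_{k=-N}^N\mathbf c_ke^{-\mathrm ik\omega_0t}.$$ Let $H$ be the associated linear time-invariant multiple-input/multiple-output system with $2N+1$ inputs and $2N+1$ outputs $$\dot{\mathbf x}(t)=\mathbf Q\mathbf x(t)+[\mathbf b_{-N},\dots,\mathbf b_N]\,\mathbf u(t),\qquad\mathbf y(t)=[\mathbf c_{-N},\dots,\mathbf c_N]^T\mathbf x(t).$$ Then $$\|\mathcal G\|_{\mathcal H_2}\le\sqrt{2N+1}\;\|H\|_{\mathcal H_2}.$$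
   Context: The impulse response of $\mathcal G$ is $g(t,\tau)=\mathbf c^T(t)e^{\mathbf Q(t-\tau)}\mathbf b(\tau)$ for $t\ge\tau$, and the $\mathcal H_2$ norm of the time-periodic system is $$\|\mathcal G\|_{\mathcal H_2}^2=\frac1T\int_0^T\int_0^\infty|g(t,t-r)|^2\,dr\,dt .$$ For a linear time-invariant system $\dot{\mathbf x}=\mathbf A\mathbf x+\mathbf B\mathbf u$, $\mathbf y=\mathbf C\mathbf x$ with impulse response $\boldsymbol g(t)=\mathbf Ce^{\mathbf At}\mathbf B$ and transfer function $\mathbf G(s)=\mathbf C(s\mathbf I-\mathbf A)^{-1}\mathbf B$, the $\mathcal H_2$ norm is $$\|\mathbf G\|_{\mathcal H_2}^2=\int_0^\infty\mathrm{trace}\big(\boldsymbol g^*(t)\boldsymbol g(t)\big)\,dt,$$ which for stable systems equals $\frac1{2\pi}\int_{-\infty}^\infty\|\mathbf G(\mathrm i\omega)\|_F^2\,d\omega$. Both norms are defined by the time-domain integrals and take the value $+\infty$ if the integral diverges. The superscript $T$ on matrices is the transpose without conjugation. *)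

(* Defs.v *)
From HB Require Import structures.
From mathcomp Require Import all_boot all_order all_algebra.
From mathcomp Require Import all_classical all_reals all_analysis.
From mathcomp Require Import complex.

Set Implicit Arguments.
Unset Strict Implicit.
Unset Printing Implicit Defensive.

Import Order.TTheory GRing.Theory Num.Theory.
Import numFieldNormedType.Exports.

Local Open Scope classical_set_scope.
Local Open Scope ring_scope.
Local Open Scope complex_scope.
Local Open Scope sesquilinear_scope.

(* The limit is taken for the sup norm on matrices, in which the exponential
   series always converges. *)
Definition expm (K : numFieldType) (n : nat) (A : 'M[K]_n) : 'M[K]_n :=
  limn (series (fun k : nat => k`!%:R^-1 *: A ^+ k)).

(* x'(t) = Q x(t) + b(t) u(t),  y(t) = c(t)^T x(t) *)
Record ltp_system (R : realType) (n : nat) := LTPSystem {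
  ltp_Q : 'M[R]_n;
  ltp_b : R -> 'cV[R]_n;
  ltp_c : R -> 'cV[R]_n }.

(* Meaningful for tau <= t only. *)
Definition ltp_impulse (R : realType) (n : nat) (G : ltp_system R n)
    (t tau : R) : R :=
  ((ltp_c G t)^T *m expm ((t - tau) *: ltp_Q G) *m ltp_b G tau) 0 0.

Definition ltp_h2norm (R : realType) (n : nat) (T : R) (G : ltp_system R n) :
    \bar R :=
  sqrte ((T^-1)%:E *
    \int[lebesgue_measure]_(t in `[0%R, T])
      \int[lebesgue_measure]_(r in `[0%R, +oo[)
        (`|ltp_impulse G t (t - r)| ^+ 2)%:E)%E.

(* x' = A x + B u,  y = C x, with n states, m inputs and p outputs *)
Record lti_system (R : realType) (n m p : nat) := LTISystem {
  lti_A : 'M[R[i]]_n;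
  lti_B : 'M[R[i]]_(n, m);
  lti_C : 'M[R[i]]_(p, n) }.

Definition lti_impulse (R : realType) (n m p : nat) (H : lti_system R n m p)
    (t : R) : 'M[R[i]]_(p, m) :=
  lti_C H *m expm (t%:C *: lti_A H) *m lti_B H.

(* The trace is real (and nonnegative), so that taking its real part only
   changes its type from R[i] to R. *)
Definition lti_h2norm (R : realType) (n m p : nat) (H : lti_system R n m p) :
    \bar R :=
  sqrte (\int[lebesgue_measure]_(t in `[0%R, +oo[)
    (complex.Re (\tr ((lti_impulse H t)^t* *m lti_impulse H t)))%:E)%E.

Definition expi (R : realType) (x : R) : R[i] := cos x +i* sin x.

(* The ordinals j < 2N+1 enumerate the frequencies -N, ..., N increasingly. *)
Definition freq (N : nat) (j : 'I_(2 * N + 1)) : int := j%:Z - N%:Z.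

Definition fourier_sum (R : realType) (n N : nat) (w : R)
    (a : int -> 'cV[R[i]]_n) (t : R) : 'cV[R[i]]_n :=
  \sum_(j < 2 * N + 1) expi (- ((freq j)%:~R * w * t)) *: a (freq j).

(* [a_{-N}, ..., a_N] *)
Definition coef_mx (R : realType) (n N : nat) (a : int -> 'cV[R[i]]_n) :
    'M[R[i]]_(n, 2 * N + 1) :=
  \matrix_(i < n, j < 2 * N + 1) a (freq j) i 0.

Definition assoc_lti (R : realType) (n N : nat) (Q : 'M[R]_n)
    (bk ck : int -> 'cV[R[i]]_n) :
    lti_system R n (2 * N + 1) (2 * N + 1) :=
  LTISystem (map_mx (real_complex R) Q) (coef_mx N bk) (coef_mx N ck)^T.

(* Main.v *)
Require Import Defs.
From HB Require Import structures.
From mathcomp Require Import all_boot all_order all_algebra.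
From mathcomp Require Import all_classical all_reals all_analysis.
From mathcomp Require Import complex.
From mathcomp Require Import measurable_realfun.
From mathcomp Require Import ring lra.
Set Implicit Arguments.
Unset Strict Implicit.
Unset Printing Implicit Defensive.
Import Order.TTheory GRing.Theory Num.Theory.
Import numFieldNormedType.Exports.

(** The impulse response of the periodic system is a trigonometric sum in t
    whose coefficients are the entries of the impulse response M(r) of the
    associated time-invariant system:
      g(t, t - r) = \sum_k e^{-i k w (t - r)} \sum_j e^{-i j w t} M_{jk}(r).
    The outer sum has 2N+1 terms, each a unimodular factor times a sum over j.
    The Cauchy-Schwarz inequality, applied to the outer sum only, gives
      |g(t, t - r)|^2 <= (2N+1) \sum_k |\sum_j e^{-i j w t} M_{jk}(r)|^2.
    Estimating the inner sum in the same way would cost another factor 2N+1;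
    instead, the average over a period in t turns it into
    \sum_j |M_{jk}(r)|^2 exactly, by orthogonality of the exponentials
    (Parseval).  Since the integrand is nonnegative, Tonelli's theorem lets this
    average be taken before the integral over r, whether or not the latter is
    finite, and what remains is (2N+1) times the integral of the squared
    Frobenius norm of M(r).

    Besides this computation (ltp_impulse_fourier, normsq_sum_le, trig_parseval,
    tonelli_on), the matrix exponential has to be controlled: its entries are
    limits of entrywise convergent series, hence measurable in r, and the
    exponential of a real matrix is the same whether it is computed over the
    reals or over the complex numbers. *)

Local Open Scope ring_scope.

(** * Entries of the matrix exponential *)

Local Open Scope classical_set_scope.

Lemma cvg_mx_entry (K : numFieldType) (m n : nat) (f : nat -> 'M[K]_(m, n))
    (M : 'M[K]_(m, n)) :
  (forall i j, f k i j @[k --> \oo] --> M i j) -> f @ \oo --> M.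
Proof.
move=> fM A [P MP PA]; rewrite nbhs_filterE; apply: filterS PA _.
have : \forall k \near \oo, forall i j, P i j (f k i j).
  by apply: filter_forall => i; apply: filter_forall => j; exact: fM (MP i j).
by [].
Qed.

Definition expm_term (K : numFieldType) (n : nat) (A : 'M[K]_n) (k : nat) :
    'M[K]_n :=
  k`!%:R^-1 *: A ^+ k.

(** The limit in the definition of the exponential is taken in the space of
    matrices; this reduces it to limits of scalar sequences, over any base
    field, so that it serves for the real and for the complex exponential. *)
Lemma expm_eq (K : numFieldType) (n : nat) (A M : 'M[K]_n) :
  (forall i j, (\sum_(0 <= k < N) expm_term A k i j) @[N --> \oo] --> M i j) ->
  expm A = M.
Proof.
move=> AM; apply: cvg_lim; first exact: norm_hausdorff.
apply: cvg_mx_entry => i j; under eq_fun do rewrite /series /= summxE.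
exact: AM.
Qed.

(** The sum of the norms of all entries dominates the norm of every column, so
    each multiplication by A costs at most this factor.  The bound also holds
    for k = 0, and it makes the exponential series of a scalar a majorant. *)
Lemma mx_exp_entry_le (K : numFieldType) (n : nat) (A : 'M[K]_n) (k : nat) i j :
  `|(A ^+ k) i j| <= (\sum_p \sum_q `|A p q|) ^+ k.
Proof.
elim: k i j => [|k IH] i j.
  by rewrite !expr0 mxE; case: (_ == _); rewrite /= ?normr1 ?normr0.
rewrite exprSr mxE (le_trans (ler_norm_sum _ _ _))//.
rewrite exprSr mulr_sumr; apply: ler_sum => p _.
rewrite normrM ler_pM//.
by rewrite (bigD1 j)//= lerDl sumr_ge0.
Qed.

Lemma is_cvg_expm (R : realType) (n : nat) (A : 'M[R]_n) i j :
  cvgn (fun N => \sum_(0 <= k < N) expm_term A k i j).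
Proof.
set C := \sum_p \sum_q `|A p q|.
apply: (@normed_cvg _ R^o (fun k => expm_term A k i j)).
apply: series_le_cvg (is_cvg_series_exp_coeff C) => k //=.
  by rewrite exp_coeff_ge0// /C sumr_ge0// => p _; rewrite sumr_ge0.
rewrite mxE normrM ger0_norm ?invr_ge0// mulrC ler_wpM2r ?invr_ge0//.
exact: mx_exp_entry_le.
Qed.

Lemma cvg_expm (R : realType) (n : nat) (A : 'M[R]_n) i j :
  (\sum_(0 <= k < N) expm_term A k i j) @[N --> \oo] --> expm A i j.
Proof.
suff -> : expm A =
    \matrix_(i, j) limn (fun N => \sum_(0 <= k < N) expm_term A k i j).
  by rewrite mxE; exact: is_cvg_expm.
by apply: expm_eq => p q; rewrite mxE; exact: is_cvg_expm.
Qed.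

(** The topology of the complex numbers comes from their complex-valued norm:
    a radius e > 0 has zero imaginary part, so it is a real radius. *)
Lemma cvg_real_complex (R : realType) (u : nat -> R) (l : R) :
  u @ \oo --> l -> ((u k)%:C%C : R[i]^o) @[k --> \oo] --> (l%:C%C : R[i]^o).
Proof.
move=> ul; apply/cvgrPdist_lt => e; rewrite ltcE /= => /andP[/eqP e0 e_gt0].
move/cvgrPdist_lt : ul => /(_ _ e_gt0); apply: filterS => k.
rewrite -rmorphB normc_def /= expr0n addr0 sqrtr_sqr => lk.
by rewrite ltcE /= e0 eqxx.
Qed.

Lemma map_mxX (R S : comNzRingType) (f : {rmorphism R -> S}) n (A : 'M[R]_n) k :
  map_mx f (A ^+ k) = map_mx f A ^+ k.
Proof.
by elim: k => [|k IH]; rewrite ?expr0 ?map_mx1// !exprS map_mxM IH.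
Qed.

(** Connects the two systems: one is stated with the real exponential, the
    other with the exponential of the same matrix seen over the complex
    numbers. *)
Lemma expm_map_complex (R : realType) (n : nat) (A : 'M[R]_n) :
  expm (map_mx (real_complex R) A) = map_mx (real_complex R) (expm A).
Proof.
apply: expm_eq => i j; rewrite mxE.
under eq_fun => N.
  under eq_bigr => k _ do
    rewrite /expm_term -map_mxX !mxE -[k`!%:R](rmorph_nat (real_complex R))
      -fmorphV -rmorphM.
  rewrite -rmorph_sum; over.
apply: cvg_real_complex.
have := @cvg_expm _ _ A i j.
by under eq_fun do under eq_bigr do rewrite mxE.
Qed.

(** A pointwise limit of polynomials in r. *)
Lemma measurable_expm_entry (R : realType) (n : nat) (A : 'M[R]_n) i j :
  measurable_fun [set: measurableTypeR R] (fun r : R => expm (r *: A) i j).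
Proof.
apply: (measurable_fun_cvg (T := measurableTypeR R)
    (h := fun N (r : R) => \sum_(0 <= k < N) expm_term (r *: A) k i j)).
  move=> N; apply: measurable_sum => k.
  rewrite (_ : (fun _ => _) = fun r : R => r ^+ k * (expm_term A k i j)).
    by apply: measurable_funM => //; exact: exprn_measurable.
  apply/funext => r; rewrite !mxE.
  have -> : (r *: A) ^+ k = r ^+ k *: A ^+ k.
    elim: k => [|k IH]; first by rewrite !expr0 scale1r.
    by rewrite !exprS IH -!mulmxE -scalemxAl -scalemxAr scalerA.
  by rewrite mxE mulrCA.
by move=> r _; exact: cvg_expm.
Qed.

(** * Squared moduli and the impulse response as a Fourier sum *)

Local Open Scope complex_scope.
Local Open Scope sesquilinear_scope.

(** The squared modulus as a real number; the norm of a complex number is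
    itself complex. *)
Definition normsq (R : realType) (z : R[i]) : R :=
  complex.Re z ^+ 2 + complex.Im z ^+ 2.

Lemma normsq_ge0 (R : realType) (z : R[i]) : 0 <= normsq z.
Proof. by rewrite addr_ge0 ?sqr_ge0. Qed.

Lemma normsqM (R : realType) (z1 z2 : R[i]) :
  normsq (z1 * z2) = normsq z1 * normsq z2.
Proof. by case: z1 z2 => [a b] [c d]; rewrite /normsq /=; ring. Qed.

Lemma normsq_expi (R : realType) (x : R) : normsq (expi x) = 1.
Proof. exact: cos2Dsin2. Qed.

Lemma normsq_real (R : realType) (x : R) : normsq x%:C = x ^+ 2.
Proof. by rewrite /normsq /= expr0n addr0. Qed.

(** Cauchy-Schwarz against the constant sequence 1: the difference of the two
    sides is half of the double sum of the squares (x_i - x_j)^2. *)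
Lemma sqr_sum_le (R : realType) (m : nat) (x : 'I_m -> R) :
  (\sum_i x i) ^+ 2 <= m%:R * \sum_i x i ^+ 2.
Proof.
set S := \sum_i x i; set S2 := \sum_i x i ^+ 2.
have row i : \sum_j (x i - x j) ^+ 2 = m%:R * x i ^+ 2 - 2 * x i * S + S2.
  under eq_bigr => j _ do rewrite sqrrB -mulr_natl mulrA.
  by rewrite big_split sumrB /= sumr_const card_ord -mulr_sumr
    -[_ *+ m]mulr_natl.
suff : 0 <= \sum_i \sum_j (x i - x j) ^+ 2.
  under eq_bigr => i _ do rewrite row.
  rewrite big_split sumrB /= sumr_const card_ord -!mulr_sumr -mulr_suml.
  rewrite -mulr_sumr -/S -/S2 -[_ *+ m]mulr_natl.
  by lra.
by apply: sumr_ge0 => i _; apply: sumr_ge0 => j _; rewrite sqr_ge0.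
Qed.

Lemma normsq_sum_le (R : realType) (m : nat) (z : 'I_m -> R[i]) :
  normsq (\sum_i z i) <= m%:R * \sum_i normsq (z i).
Proof.
rewrite /normsq !raddf_sum big_split mulrDr /=.
by apply: lerD; exact: sqr_sum_le.
Qed.

(** The integrand of the norm of a time-invariant system is the squared
    Frobenius norm of its impulse response. *)
Lemma trace_normsq (R : realType) (p q : nat) (M : 'M[R[i]]_(p, q)) :
  complex.Re (\tr (M^t* *m M)) = \sum_k \sum_j normsq (M j k).
Proof.
rewrite /mxtrace raddf_sum; apply: eq_bigr => k _.
rewrite mxE raddf_sum; apply: eq_bigr => j _; rewrite !mxE /normsq.
by case: (M j k) => a b /=; ring.
Qed.

Lemma fourier_sumE (R : realType) (n N : nat) (w : R)
    (a : int -> 'cV[R[i]]_n) t :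
  fourier_sum N w a t =
    coef_mx N a *m \col_j expi (- ((freq j)%:~R * w * t)).
Proof.
apply/colP => i; rewrite summxE mxE; apply: eq_bigr => j _.
by rewrite !mxE mulrC.
Qed.

(** Substitute the Fourier sums of b and c into c(t)^T e^{Qr} b(t - r); by
    bilinearity the coefficients are the entries of C e^{Qr} B. *)
Lemma ltp_impulse_fourier (R : realType) (n N : nat) (w : R) (Q : 'M[R]_n)
    (b c : R -> 'cV[R]_n) (bk ck : int -> 'cV[R[i]]_n) (t r : R) :
  (forall t, map_mx (real_complex R) (b t) = fourier_sum N w bk t) ->
  (forall t, map_mx (real_complex R) (c t) = fourier_sum N w ck t) ->
  (ltp_impulse (LTPSystem Q b c) t (t - r))%:C =
  \sum_k (\sum_j expi (- ((freq j)%:~R * w * t)) *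
       lti_impulse (assoc_lti N Q bk ck) r j k) *
     expi (- ((freq k)%:~R * w * (t - r))).
Proof.
move=> hb hc; rewrite /ltp_impulse /= subKr.
set E := expm _; set M := lti_impulse _ r.
have -> : M = (coef_mx N ck)^T *m map_mx (real_complex R) E *m coef_mx N bk.
  by rewrite /M /lti_impulse /= -map_mxZ expm_map_complex.
transitivity (map_mx (real_complex R) ((c t)^T *m E *m b (t - r)) 0 0).
  by rewrite [RHS]mxE.
rewrite !map_mxM -map_trmx hb hc !fourier_sumE trmx_mul !mulmxA.
rewrite mxE; apply: eq_bigr => k _; rewrite [X in _ * X = _]mxE; congr (_ * _).
by rewrite -!mulmxA mxE; apply: eq_bigr => j _; rewrite !mxE.
Qed.

(** * Mean value of a squared trigonometric sum over a period *)

Lemma cos_sin_int (R : realType) (z : int) :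
  cos (z%:~R * (pi *+ 2) : R) = 1 /\ sin (z%:~R * (pi *+ 2) : R) = 0.
Proof.
have cs k : cos (k%:R * (pi *+ 2) : R) = 1 /\ sin (k%:R * (pi *+ 2) : R) = 0.
  rewrite mulr_natl -[_ *+ k]add0r.
  by rewrite (periodicn (@cosD2pi R)) (periodicn (@sinD2pi R)) cos0 sin0.
case: z => k; first exact: cs.
rewrite NegzE mulrNz mulNr cosN sinN.
by have [-> ->] := cs k.+1; rewrite oppr0.
Qed.

Lemma freq_inj N : injective (@freq N).
Proof. by move=> j l /addIr[/val_inj]. Qed.

(** The real form of a single frequency d, for which the cross terms of a
    squared modulus have real coefficients. *)
Definition osc (R : realType) (d a b t : R) : R :=
  a * cos (d * t) + b * sin (d * t).

Lemma is_derive_osc_primitive (R : realType) (d a b t : R) : d != 0 ->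
  is_derive t 1 (fun t => d^-1 * (a * sin (d * t) - b * cos (d * t)))
    (osc d a b t).
Proof.
move=> d0; rewrite /osc.
apply: is_derive_eq.
rewrite /GRing.scale /=; field.
exact: d0.
Qed.

(** The cross term of the indices j and l is the real part of
    e^{-i (a_j - a_l) t} z_j conj(z_l); only differences of frequencies occur. *)
Lemma normsq_trig_sum (R : realType) (m : nat) (a : 'I_m -> R)
    (z : 'I_m -> R[i]) t :
  normsq (\sum_j expi (- (a j * t)) * z j) =
  \sum_j \sum_l osc (a j - a l)
    (complex.Re (z j) * complex.Re (z l) + complex.Im (z j) * complex.Im (z l))
    (complex.Im (z j) * complex.Re (z l) - complex.Re (z j) * complex.Im (z l))
    t.
Proof.
rewrite /normsq !raddf_sum /= !expr2 !mulr_suml -big_split.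
apply: eq_bigr => j _.
rewrite !mulr_sumr -big_split; apply: eq_bigr => l _.
rewrite /osc /expi mulrBl cosB sinB !cosN !sinN.
by case: (z j) (z l) => [x y] [x' y'] /=; ring.
Qed.

Lemma continuous_osc (R : realType) (d a b : R) : continuous (osc d a b).
Proof.
move=> t; rewrite /osc; apply: cvgD; apply: cvgM; try exact: cvg_cst.
  apply: continuous_comp; last exact: continuous_cos.
  exact: mulrl_continuous.
apply: continuous_comp; last exact: continuous_sin.
exact: mulrl_continuous.
Qed.

(** Each nonconstant oscillation has a T-periodic primitive, hence integrates to
    zero over a period; only the frequency 0 survives. *)
Lemma integral_trig_poly (R : realType) (T : R) (I : finType) (d a b : I -> R) :
  0 < T ->
  (forall i, d i != 0 -> cos (d i * T) = 1 /\ sin (d i * T) = 0) ->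
  (\int[lebesgue_measure]_(t in `[0%R, T]) (\sum_i osc (d i) (a i) (b i) t)%:E =
   (T * \sum_(i | d i == 0) a i)%:E)%E.
Proof.
move=> T0 per.
pose P i (t : R) : R := if d i == 0 then a i * t
  else (d i)^-1 * (a i * sin (d i * t) - b i * cos (d i * t)).
have dP i (t : R) : is_derive t 1 (P i) (osc (d i) (a i) (b i) t).
  rewrite /P; case: eqVneq => [d0|]; last exact: is_derive_osc_primitive.
  apply: is_derive_eq; rewrite /osc d0 !mul0r cos0 sin0 /GRing.scale /=; ring.
have dF (t : R) : is_derive t 1 (fun t => \sum_i P i t)
    (\sum_i osc (d i) (a i) (b i) t).
  elim: (index_enum I) => [|i s IH].
    under eq_fun do rewrite big_nil.
    by rewrite big_nil; exact: is_derive_cst.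
  under eq_fun do rewrite big_cons.
  by rewrite big_cons; exact: is_deriveD.
have cF : continuous (fun t => \sum_i P i t).
  move=> t; have /derivable1_diffP : derivable (fun t => \sum_i P i t) t 1.
    exact: ex_derive.
  exact: differentiable_continuous.
rewrite (@continuous_FTC2 _ _ (fun t => \sum_i P i t) _ _ T0).
- rewrite -EFinB -sumrB mulr_sumr [in RHS]big_mkcond; congr (_%:E).
  apply: eq_bigr => i _; rewrite /P; case: eqVneq => [d0|/[dup] d0 /per[c1 s0]].
    by rewrite mulr0 subr0 mulrC.
  by rewrite c1 s0 !mulr0 cos0 sin0 mulr0 subrr.
- apply: continuous_subspaceT => t.
  elim: (index_enum I) => [|i s IH].
    under eq_fun do rewrite big_nil.
    exact: cvg_cst.
  under eq_fun do rewrite big_cons.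
  by apply: cvgD => //; exact: continuous_osc.
- split.
  + by move=> t _; exact: ex_derive.
  + by apply: cvg_at_right_filter; exact: cF.
  + by apply: cvg_at_left_filter; exact: cF.
- by move=> t _; rewrite derive1E; exact: derive_val.
Qed.

(** Distinct indices have distinct frequencies, so the constant terms of the
    expanded squared modulus are exactly the diagonal ones. *)
Lemma trig_parseval (R : realType) (T : R) (N : nat)
    (z : 'I_(2 * N + 1) -> R[i]) :
  0 < T ->
  (\int[lebesgue_measure]_(t in `[0%R, T])
    (normsq (\sum_j expi (- ((freq j)%:~R * (2 * pi / T) * t)) * z j))%:E =
   (T * \sum_j normsq (z j))%:E)%E.
Proof.
move=> T0; pose a (j : 'I_(2 * N + 1)) : R := (freq j)%:~R * (2 * pi / T).
have w0 : 2 * pi / T != 0 :> R.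
  by rewrite !mulf_neq0 ?pnatr_eq0 ?invr_neq0 ?gt_eqF ?pi_gt0.
have da (p : 'I_(2 * N + 1) * 'I_(2 * N + 1)) :
    (a p.1 - a p.2 == 0) = (p.1 == p.2).
  rewrite /a -mulrBl mulf_eq0 (negbTE w0) orbF subr_eq0 eqr_int.
  by rewrite (inj_eq (@freq_inj N)).
under eq_integral do rewrite (normsq_trig_sum a) pair_big /=.
rewrite integral_trig_poly//; last first.
  move=> p _; have -> : (a p.1 - a p.2) * T =
      (freq p.1 - freq p.2)%:~R * (pi *+ 2).
    rewrite /a intrB -mulr_natl; field.
    by rewrite gt_eqF.
  exact: cos_sin_int.
congr ((_ * _)%:E); under eq_bigl do rewrite da.
rewrite -(pair_big_dep xpredT (fun j l => j == l) (fun j l => 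
  complex.Re (z j) * complex.Re (z l) + complex.Im (z j) * complex.Im (z l))) /=.
by apply: eq_bigr => j _; rewrite (big_pred1 j) => [|l];
  rewrite ?/normsq ?expr2// /= eq_sym.
Qed.

(** * Integration of nonnegative functions and measurability *)

(** Measurability is not assumed: the integral of a nonnegative function is the
    supremum of the integrals of the simple functions below it.  This allows
    comparing the iterated integrals of the periodic impulse response with
    those of its bound by pointwise inequalities alone. *)
Lemma le_integral_ge0 d (X : measurableType d) (R : realType)
    (mu : {measure set X -> \bar R}) (D : set X) (f g : X -> \bar R) :
  (forall x, D x -> (0 <= f x)%E) -> (forall x, D x -> (f x <= g x)%E) ->
  (\int[mu]_(x in D) f x <= \int[mu]_(x in D) g x)%E.
Proof.
move=> f0 fg; rewrite !(integral_mkcond D).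
have fg' x : ((f \_ D) x <= (g \_ D) x)%E.
  by rewrite !patchE; case: ifPn => // /set_mem /fg.
have f0' x : (0 <= (f \_ D) x)%E by apply: erestrict_ge0.
rewrite !ge0_integralTE //; last by move=> x; exact: le_trans (f0' x) (fg' x).
apply: le_ereal_sup => _ [h hf <-]; exists h => // x.
exact: le_trans (hf x) (fg' x).
Qed.

(** Tonelli's theorem on a rectangle, by extending f by 0 outside of it. *)
Lemma tonelli_on d1 d2 (X : measurableType d1) (Y : measurableType d2)
    (R : realType) (m1 : {sigma_finite_measure set X -> \bar R})
    (m2 : {sigma_finite_measure set Y -> \bar R}) (A : set X) (B : set Y)
    (f : X * Y -> \bar R) :
  measurable A -> measurable B -> measurable_fun setT f ->
  (forall z, (0 <= f z)%E) ->
  (\int[m1]_(x in A) \int[m2]_(y in B) f (x, y) =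
   \int[m2]_(y in B) \int[m1]_(x in A) f (x, y))%E.
Proof.
move=> mA mB mf f0; pose h := f \_ (A `*` B).
have mh : measurable_fun setT h.
  apply/(measurable_restrictT _ _).1; first exact: measurableX.
  exact: measurable_funTS.
have h0 z : (0 <= h z)%E by exact: erestrict_ge0.
have hE x y : h (x, y) =
    if x \in A then if y \in B then f (x, y) else 0%E else 0%E.
  by rewrite /h patchE in_setX; case: (x \in A).
transitivity (\int[m1]_x \int[m2]_y h (x, y))%E.
  rewrite integral_mkcond; apply: eq_integral => x _; rewrite patchE.
  case: ifPn => xA.
    rewrite integral_mkcond; apply: eq_integral => y _.
    by rewrite hE xA patchE.
  by rewrite integral0_eq// => y _; rewrite hE (negbTE xA).
rewrite fubini_tonelli//.
rewrite [RHS]integral_mkcond; apply: eq_integral => y _; rewrite patchE.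
case: ifPn => yB.
  rewrite [RHS]integral_mkcond; apply: eq_integral => x _.
  by rewrite hE yB patchE.
by rewrite integral0_eq// => x _; rewrite hE (negbTE yB); case: ifP.
Qed.

Lemma measurable_normsq d (X : measurableType d) (R : realType) (f : X -> R[i]) :
  measurable_fun setT (fun x => complex.Re (f x)) ->
  measurable_fun setT (fun x => complex.Im (f x)) ->
  measurable_fun setT (fun x => normsq (f x)).
Proof.
by move=> mre mim; apply: measurable_funD; exact: measurable_funX.
Qed.

(** The entry is a fixed complex combination of the entries of e^{rQ}. *)
Lemma measurable_lti_impulse (R : realType) (n N : nat) (Q : 'M[R]_n)
    (bk ck : int -> 'cV[R[i]]_n) j k :
  let M r := lti_impulse (assoc_lti N Q bk ck) r j k in
  measurable_fun [set: measurableTypeR R] (fun r : R => complex.Re (M r)) /\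
  measurable_fun [set: measurableTypeR R] (fun r : R => complex.Im (M r)).
Proof.
have ME (r : R) : lti_impulse (assoc_lti N Q bk ck) r j k =
    \sum_q \sum_p (expm (r *: Q) p q)%:C * (ck (freq j) p 0 * bk (freq k) q 0).
  rewrite /lti_impulse /= -map_mxZ expm_map_complex mxE; apply: eq_bigr => q _.
  rewrite mxE mulr_suml; apply: eq_bigr => p _; rewrite !mxE.
  by rewrite mulrCA mulrA.
split.
  rewrite (_ : (fun _ => _) = fun r : R => \sum_q \sum_p expm (r *: Q) p q *
      complex.Re (ck (freq j) p 0 * bk (freq k) q 0)).
    apply: measurable_sum => q; apply: measurable_sum => p.
    by apply: measurable_funM => //; exact: measurable_expm_entry.
  apply/funext => r; rewrite ME raddf_sum; apply: eq_bigr => q _.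
  rewrite raddf_sum; apply: eq_bigr => p _.
  by case: (ck _ _ _ * _) => x y /=; rewrite mul0r subr0.
rewrite (_ : (fun _ => _) = fun r : R => \sum_q \sum_p expm (r *: Q) p q *
    complex.Im (ck (freq j) p 0 * bk (freq k) q 0)).
  apply: measurable_sum => q; apply: measurable_sum => p.
  by apply: measurable_funM => //; exact: measurable_expm_entry.
apply/funext => r; rewrite ME raddf_sum; apply: eq_bigr => q _.
rewrite raddf_sum; apply: eq_bigr => p _.
by case: (ck _ _ _ * _) => x y /=; rewrite mul0r addr0.
Qed.

(** Joint measurability in (t, r), as Tonelli's theorem requires; it comes from
    writing real and imaginary parts as sums of products of a function of t and
    a function of r. *)
Lemma measurable_column_sum (R : realType) (m : nat) (a : 'I_m -> R)
    (M : 'I_m -> R -> R[i]) :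
  (forall j, measurable_fun [set: measurableTypeR R]
     (fun r : R => complex.Re (M j r))) ->
  (forall j, measurable_fun [set: measurableTypeR R]
     (fun r : R => complex.Im (M j r))) ->
  measurable_fun [set: measurableTypeR R * measurableTypeR R]
    (fun z => normsq (\sum_j expi (- (a j * z.1)) * M j z.2)).
Proof.
move=> mre mim.
have marg j : measurable_fun [set: measurableTypeR R * measurableTypeR R]
    (fun z => - (a j * z.1) : R).
  under eq_fun do rewrite -mulNr.
  by apply: measurable_funM; [exact: measurable_cst|exact: measurable_fst].
have mcos j : measurable_fun [set: measurableTypeR R * measurableTypeR R]
    (fun z => cos (- (a j * z.1)) : R).
  apply: measurableT_comp.
    by apply: continuous_measurable_fun; exact: continuous_cos.
  exact: marg.
have msin j : measurable_fun [set: measurableTypeR R * measurableTypeR R]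
    (fun z => sin (- (a j * z.1)) : R).
  apply: measurableT_comp.
    by apply: continuous_measurable_fun; exact: continuous_sin.
  exact: marg.
have mre2 j : measurable_fun [set: measurableTypeR R * measurableTypeR R]
    (fun z => complex.Re (M j z.2)).
  exact: (measurableT_comp (mre j) measurable_snd).
have mim2 j : measurable_fun [set: measurableTypeR R * measurableTypeR R]
    (fun z => complex.Im (M j z.2)).
  exact: (measurableT_comp (mim j) measurable_snd).
apply: measurable_normsq.
  rewrite (_ : (fun _ => _) = fun z => \sum_j
      (cos (- (a j * z.1)) * complex.Re (M j z.2) -
       sin (- (a j * z.1)) * complex.Im (M j z.2))).
    by apply: measurable_sum => j; apply: measurable_funB;
      apply: measurable_funM.
  apply/funext => z; rewrite raddf_sum; apply: eq_bigr => j _.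
  by case: (M j z.2).
rewrite (_ : (fun _ => _) = fun z => \sum_j
    (cos (- (a j * z.1)) * complex.Im (M j z.2) +
     sin (- (a j * z.1)) * complex.Re (M j z.2))).
  by apply: measurable_sum => j; apply: measurable_funD; apply: measurable_funM.
apply/funext => z; rewrite raddf_sum; apply: eq_bigr => j _.
by case: (M j z.2).
Qed.

(** * The norm inequality *)

Local Close Scope sesquilinear_scope.
Local Close Scope complex_scope.
Local Close Scope classical_set_scope.

Theorem theorem4p1 (R : realType) (n N : nat) (T : R) (hT : 0 < T)
  (Q : 'M[R]_n) (b c : R -> 'cV[R]_n) (bk ck : int -> 'cV[R[i]]_n)
  (hb_per : periodic b T) (hc_per : periodic c T)
  (hb : forall t : R,
     map_mx (real_complex R) (b t) = fourier_sum N (2 * pi / T) bk t)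
  (hc : forall t : R,
     map_mx (real_complex R) (c t) = fourier_sum N (2 * pi / T) ck t) :
  (ltp_h2norm T (LTPSystem Q b c)
     <= (Num.sqrt (2 * N + 1)%N%:R)%:E * lti_h2norm (assoc_lti N Q bk ck))%E.
Proof.
set m := (2 * N + 1)%N; set w := 2 * pi / T.
pose M r := lti_impulse (assoc_lti N Q bk ck) r.
pose F (z : R * R) : R :=
  \sum_k normsq (\sum_j expi (- ((freq j)%:~R * w * z.1)) * M z.2 j k).
have F0 z : 0 <= F z by apply: sumr_ge0 => k _; exact: normsq_ge0.
have mM (j k : 'I_(2 * N + 1)) := measurable_lti_impulse Q bk ck j k.
have mcol k : measurable_fun [set: measurableTypeR R * measurableTypeR R]
    (fun z => normsq (\sum_j expi (- ((freq j)%:~R * w * z.1)) * M z.2 j k)).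
  by apply: (measurable_column_sum _ (M := fun j r => M r j k)) => j;
    case: (mM j k).
have mF : measurable_fun [set: measurableTypeR R * measurableTypeR R] F.
  by apply: measurable_sum => k; exact: mcol.
have mtr : measurable_fun [set: measurableTypeR R]
    (fun r : R => \sum_k \sum_j normsq (M r j k)).
  apply: measurable_sum => k; apply: measurable_sum => j.
  by case: (mM j k) => *; exact: measurable_normsq.
(* Cauchy-Schwarz on the sum over k only, whose phases have modulus 1. *)
have pointwise (t r : R) :
    `|ltp_impulse (LTPSystem Q b c) t (t - r)| ^+ 2 <= m%:R * F (t, r).
  rewrite real_normK ?num_real// -normsq_real (ltp_impulse_fourier Q t r hb hc).
  rewrite (le_trans (normsq_sum_le _))// ler_wpM2l//.
  by apply: ler_sum => k _; rewrite normsqM normsq_expi mulr1.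
(* Orthogonality in t, for each column k of M r separately. *)
have averaged (r : R) :
    (\int[lebesgue_measure]_(t in `[0%R, T]%classic) (F (t, r))%:E =
    (T * \sum_k \sum_j normsq (M r j k))%:E)%E.
  under eq_integral do rewrite /F -sumEFin.
  rewrite ge0_integral_sum//=.
  - by rewrite mulr_sumr -sumEFin; apply: eq_bigr => k _; exact: trig_parseval.
  - move=> k; apply/measurable_EFinP; apply: measurable_funTS.
    exact: (measurable_fun_pair1 _ (mcol k)).
  - by move=> k t _; rewrite lee_fin normsq_ge0.
rewrite /ltp_h2norm /lti_h2norm.
(* Both sides are square roots, so it suffices to compare the radicands. *)
rewrite (_ : (Num.sqrt m%:R)%:E = sqrte m%:R%:E)//.
rewrite -sqrteM ?lee_fin// lee_sqrt; last first.
  rewrite mule_ge0 ?lee_fin// integral_ge0// => r _.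
  rewrite lee_fin trace_normsq; apply: sumr_ge0 => k _; apply: sumr_ge0 => j _.
  exact: normsq_ge0.
under [X in (_ <= _ * X)%E]eq_integral do rewrite trace_normsq.
rewrite lee_pdivrMl//.
apply: (@le_trans _ _ (\int[lebesgue_measure]_(t in `[0%R, T]%classic)
   \int[lebesgue_measure]_(r in `[0%R, +oo[%classic) (m%:R * F (t, r))%:E)%E).
  apply: le_integral_ge0 => t _.
    by apply: integral_ge0 => r _; rewrite lee_fin sqr_ge0.
  by apply: le_integral_ge0 => r _; rewrite lee_fin// sqr_ge0.
rewrite (tonelli_on lebesgue_measure lebesgue_measure
  (f := fun z => (m%:R * F z)%:E))//; last 2 first.
- by apply/measurable_EFinP; apply: measurable_funM.
- by move=> z; rewrite lee_fin mulr_ge0.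
(* After the exchange, the inner integral is computed exactly by averaging. *)
rewrite le_eqVlt; apply/orP; left; apply/eqP.
have Tm0 : 0 <= T * m%:R by rewrite mulr_ge0// ltW.
rewrite muleA -EFinM -ge0_integralZl_EFin//; last 2 first.
- by move=> r _; rewrite lee_fin; apply: sumr_ge0 => k _;
    apply: sumr_ge0 => j _; exact: normsq_ge0.
- by apply/measurable_EFinP; exact: measurable_funTS.
apply: eq_integral => r _.
under eq_integral do rewrite EFinM.
rewrite ge0_integralZl_EFin//=; last 2 first.
- by move=> t _; rewrite lee_fin.
- apply/measurable_EFinP; apply: measurable_funTS.
  exact: measurable_fun_pair1 mF.
by rewrite averaged -!EFinM mulrA [m%:R * T]mulrC.
Qed.
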